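(* Let $(X_1,Y_1),\dots,(X_n,Y_n)\in\mathbb{R}^{d}\times\mathbb{R}$ be given data with empirical distribution $P_n=\frac1n\sum_{i=1}^n\delta_{(X_i,Y_i)}$, let $G_1,\dots,G_{\bar d}$ be a partition of $\{1,\dots,d\}$ into non-empty sets, let $q,t\in[1,\infty]$ and let $\alpha=(\alpha_1,\dots,\alpha_{\bar d})^T$ with all $\alpha_i>0$. Let $p,s$ satisfy $1/p+1/q=1$ and $1/s+1/t=1$. Let the cost function be $$c\big((x,y),(x',y')\big)=\begin{cases}\|x-x'\|_{\alpha^{-1}\text{-}(q,t)}^{2} & \text{if } y=y',\\ \infty & \text{if } y\neq y',\end{cases}$$ and let $l(x,y;\beta)=(y-x^T\beta)^2$. Then for every $\delta>0$, $$\min_{\beta\in\mathbb{R}^d}\ \sup_{P:\,\mathcal{D}_c(P,P_n)\le\delta}\big(\mathbb{E}_P[l(X,Y;\beta)]\big)^{1/2}=\min_{\beta\in\mathbb{R}^d}\Big\{\big(\mathbb{E}_{P_n}[l(X,Y;\beta)]\big)^{1/2}+\sqrt{\delta}\,\|\beta\|_{\alpha\text{-}(p,s)}\Big\}.$$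
   Context: Vectors are column vectors. For $x\in\mathbb{R}^d$ and $G\subseteq\{1,\dots,d\}$, $x(G)$ denotes the sub-vector of $x$ with coordinates indexed by $G$. For $p,s\ge1$ and $\alpha\in\mathbb{R}^{\bar d}$ with positive entries, $$\|x\|_{\alpha\text{-}(p,s)}=\Big(\sum_{i=1}^{\bar d}\alpha_i^{s}\|x(G_i)\|_p^{s}\Big)^{1/s},$$ where $\|\cdot\|_p$ is the usual $\ell_p$ norm; when $s=\infty$ this is $\max_i \alpha_i\|x(G_i)\|_p$. Also $\alpha^{-1}=(\alpha_1^{-1},\dots,\alpha_{\bar d}^{-1})^T$. For a lower semicontinuous $c:\mathbb{R}^{d+1}\times\mathbb{R}^{d+1}\to[0,\infty]$ with $c(u,w)=0$ iff $u=w$, and probability distributions $P,Q$ on $\mathbb{R}^{d+1}$ with supports $\mathcal{S}_P,\mathcal{S}_Q$, the optimal transport discrepancy is $$\mathcal{D}_c(P,Q)=\inf\{\mathbb{E}_\pi[c(U,W)]:\ \pi \text{ a probability distribution on } \mathcal{S}_P\times\mathcal{S}_Q,\ \pi_U=P,\ \pi_W=Q\},$$ where $\pi_U,\pi_W$ are the marginals of $U$ and $W$ under $\pi$. The supremum is over probability distributions $P$ on $\mathbb{R}^{d+1}$, and $\mathbb{E}_P$ is expectation when $(X,Y)\sim P$. *)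

(* Defs.v *)
From HB Require Import structures.
From mathcomp Require Import all_boot all_order all_algebra.
From mathcomp Require Import all_classical all_reals all_analysis.
Set Implicit Arguments.
Unset Strict Implicit.
Unset Printing Implicit Defensive.
Import Order.TTheory GRing.Theory Num.Theory.
Import numFieldNormedType.Exports.
Local Open Scope classical_set_scope.
Local Open Scope ring_scope.

Section norms.
Context {R : realType}.

(* x(G), listed in increasing order of the indices in G *)
Definition subvector d (x : 'cV[R]_d) (G : {set 'I_d}) : 'cV[R]_#|G| :=
  \col_k x (enum_val k) 0.

(* The exponents range over [1, +oo]; the value at -oo is junk. *)
Definition lpnorm (p : \bar R) d (x : 'cV[R]_d) : R :=
  match p with
  | r%:E => (\sum_j `|x j 0| `^ r) `^ r^-1
  | +oo%E => \big[Num.max/0]_j `|x j 0|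
  | -oo%E => 0
  end.

Definition group_norm d k (G : 'I_k -> {set 'I_d}) (alpha : 'cV[R]_k)
    (p s : \bar R) (x : 'cV[R]_d) : R :=
  match s with
  | r%:E =>
      (\sum_i alpha i 0 `^ r * lpnorm p (subvector x (G i)) `^ r) `^ r^-1
  | +oo%E => \big[Num.max/0]_i (alpha i 0 * lpnorm p (subvector x (G i)))
  | -oo%E => 0
  end.

End norms.

Definition is_indexed_partition d k (G : 'I_k -> {set 'I_d}) : Prop :=
  [/\ forall i, G i != finset.set0,
      forall i j, i != j -> ([disjoint G i & G j])%B
    & forall a, exists i, a \in G i].

(* R^(d+1), as pairs (x, y), with its Borel sigma-algebra *)
Notation data_space R d := (g_sigma_algebraType (@open ('cV[R]_d * R)%type)).

Section empirical.
Context {disp : measure_display} {T : measurableType disp} {R : realType}.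
Variables (n : nat) (Z : 'I_n.+1 -> T).
Local Open Scope ereal_scope.

Definition empirical (A : set T) : \bar R :=
  ((n.+1%:R : R)^-1)%R%:E * \sum_(i < n.+1) \d_(Z i) A.

Let empiricalE : empirical =
  mscale (((n.+1%:R : R)^-1)%:nng)%R (msum (fun i => \d_(Z (inord i))) n.+1).
Proof.
apply/funext => A; rewrite /empirical /mscale /msum /=; congr (_ * _).
by apply: eq_bigr => i _; rewrite inord_val.
Qed.

Let empirical0 : empirical set0 = 0.
Proof. by rewrite empiricalE measure0. Qed.

Let empirical_ge0 A : 0 <= empirical A.
Proof. by rewrite empiricalE measure_ge0. Qed.

Let empirical_sigma_additive : semi_sigma_additive empirical.
Proof. by rewrite empiricalE; exact: measure_semi_sigma_additive. Qed.

HB.instance Definition _ := isMeasure.Build _ _ _ empirical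
  empirical0 empirical_ge0 empirical_sigma_additive.

Let empirical_setT : empirical setT = 1.
Proof.
rewrite /empirical (eq_bigr (fun=> 1%:E)); last by move=> i _; rewrite diracT.
by rewrite sumEFin sumr_const card_ord -EFinM mulVf// pnatr_eq0.
Qed.

HB.instance Definition _ :=
  Measure_isProbability.Build _ _ _ empirical empirical_setT.

End empirical.

Section optimal_transport.
Context {R : realType} {d : nat}.
Local Notation E := (data_space R d).
Local Open Scope ereal_scope.

Definition support (P : probability E R) : set E :=
  [set z | forall U : set ('cV[R]_d * R), open U -> U z -> 0 < P U].

(* A probability distribution on S_P x S_Q is encoded as one on E x E giving
   full mass to S_P x S_Q. *)
Definition couplings (P Q : probability E R) : set (probability (E * E)%type R) :=
  [set pi : probability (E * E)%type R |
    [/\ pi (support P `*` support Q) = 1,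
        forall A : set E, measurable A -> pi (fst @^-1` A) = P A
      & forall A : set E, measurable A -> pi (snd @^-1` A) = Q A]].

Definition ot_discrepancy (c : E -> E -> \bar R) (P Q : probability E R) :
    \bar R :=
  ereal_inf [set \int[pi]_z c z.1 z.2 | pi in couplings P Q].

Definition transport_cost k (G : 'I_k -> {set 'I_d}) (alpha : 'cV[R]_k)
    (q t : \bar R) (z w : E) : \bar R :=
  if z.2 == w.2
  then (group_norm G (map_mx GRing.inv alpha) q t (z.1 - w.1) ^+ 2)%:E
  else +oo.

Definition squared_loss (beta : 'cV[R]_d) (z : E) : R :=
  ((z.2 - (z.1^T *m beta) 0 0) ^+ 2)%R.

End optimal_transport.

Definition is_minimum {R : realType} T (f : T -> \bar R) (v : \bar R) : Prop :=
  (exists b, f b = v) /\ forall b, (v <= f b)%E.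

(* Main.v *)
Require Import Defs.
From HB Require Import structures.
From mathcomp Require Import all_boot all_order all_algebra.
From mathcomp Require Import all_classical all_reals all_analysis.
From mathcomp Require Import measurable_realfun.
From mathcomp Require Import ring lra.
Set Implicit Arguments.
Unset Strict Implicit.
Unset Printing Implicit Defensive.
Import Order.TTheory GRing.Theory Num.Theory.
Import numFieldNormedType.Exports.
Local Open Scope classical_set_scope.
Local Open Scope ring_scope.

(** For each fixed [b] the worst-case root loss equals
    [sqrt (E_Pn l) + sqrt delta * N b], where [N] is the alpha-(p,s) norm, so
    the two objectives are the same function; it attains its minimum because
    it is continuous and [N] is coercive.

    Upper bound: under a coupling [(U, W)] of [P] and [Pn], Hoelder's
    inequality (inside the groups, then across them) bounds the difference of
    the residuals at [U] and [W] by [N b] times the square root of the cost,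
    and Minkowski's inequality in L2 concludes.  Lower bound: move each data
    point along a vector [v] of dual norm at most 1 with [b . v = N b], by an
    amount proportional to its residual; all the inequalities above become
    equalities. *)

(** * Finite-dimensional l_p norms: Hoelder's inequality and its equality case *)

Section lp.
Context {R : realType}.

(** Lets later arguments divide by norms and roots that may vanish: each is first enlarged by [e],
    and the slack is removed here. *)
Lemma le_addM_eps (v a b c : R) : 0 <= b -> 0 <= c ->
  (forall e, 0 < e -> v <= (a + e) + (b + e) * (c + e)) -> v <= a + b * c.
Proof.
move=> b0 c0 h; apply/ler_addgt0Pr => e e0.
pose m := Num.min 1 (e / (2 + b + c)).
have D : 0 < 2 + b + c by lra.
have m0 : 0 < m by rewrite lt_min ltr01 divr_gt0.
have m1 : m <= 1 by rewrite ge_min lexx.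
have me : m * (2 + b + c) <= e by rewrite -ler_pdivlMr// ge_min lexx orbT.
apply: (le_trans (h _ m0)).
have -> : a + m + (b + m) * (c + m) = a + b * c + m * (1 + b + c + m) by ring.
rewrite lerD2l; apply: le_trans me.
by rewrite ler_pM2l//; lra.
Qed.

Lemma lpnorm_ge0 (p : \bar R) d (x : 'cV[R]_d) : 0 <= lpnorm p x.
Proof.
case: p => [r| |] //=; first exact: powR_ge0.
by apply: bigmax_ge_id.
Qed.

Lemma ler_lpnorm (p : \bar R) d (x y : 'cV[R]_d) : (1 <= p)%E ->
  (forall j, `|x j 0| <= `|y j 0|) -> lpnorm p x <= lpnorm p y.
Proof.
case: p => [r| |] p1 xy /=; last by [].
  have r0 : 0 <= r by rewrite -lee_fin; exact: le_trans p1.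
  apply: ge0_ler_powR; rewrite ?invr_ge0 ?nnegrE//.
  - by apply: sumr_ge0 => *; exact: powR_ge0.
  - by apply: sumr_ge0 => *; exact: powR_ge0.
  - by apply: ler_sum => j _; apply: ge0_ler_powR; rewrite ?nnegrE.
by apply: le_bigmax2 => j _; exact: xy.
Qed.

Lemma lpnormZ (p : \bar R) d a (x : 'cV[R]_d) : (1 <= p)%E ->
  lpnorm p (a *: x) = `|a| * lpnorm p x.
Proof.
case: p => [r| |] //=; rewrite ?lee_fin => r1.
  have r0 : r != 0 by rewrite gt_eqF//; lra.
  under eq_bigr do rewrite mxE normrM powRM//.
  rewrite -mulr_sumr powRM ?powR_ge0//; last first.
    by apply: sumr_ge0 => *; exact: powR_ge0.
  by rewrite -powRrM divff// powRr1.
under eq_bigr do rewrite mxE normrM.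
elim/big_ind2 : _ => [|u u' v v' -> ->|//]; first by rewrite mulr0.
by rewrite maxr_pMr.
Qed.

Lemma lpnorm0 (p : \bar R) d : (1 <= p)%E -> lpnorm p (0 : 'cV[R]_d) = 0.
Proof.
by move=> p1; rewrite -(scale0r (0 : 'cV[R]_d)) lpnormZ// normr0 mul0r.
Qed.

Variant conjugate_exponents : \bar R -> \bar R -> Prop :=
| Conjugate1y : conjugate_exponents 1%E +oo%E
| Conjugatey1 : conjugate_exponents +oo%E 1%E
| ConjugateFin r r' of 1 < r & 1 < r' & r^-1 + r'^-1 = 1 :
    conjugate_exponents r%:E r'%:E.

Lemma conjugate_exponentsP (p q : \bar R) : (1 <= p)%E -> (1 <= q)%E ->
  (p^-1 + q^-1 = 1)%E -> conjugate_exponents p q.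
Proof.
case: p => [r| |]//; case: q => [r'| |] //; rewrite ?lee_fin => p1 q1.
- have r0 : r != 0 by rewrite gt_eqF//; lra.
  have r'0 : r' != 0 by rewrite gt_eqF//; lra.
  rewrite !inver (negbTE r0) (negbTE r'0) -EFinD => -[] h.
  have i0 : 0 < r^-1 by rewrite invr_gt0; lra.
  have i'0 : 0 < r'^-1 by rewrite invr_gt0; lra.
  by apply: ConjugateFin => //; rewrite -invf_lt1; lra.
- rewrite invey adde0 => /eqP; rewrite inve_eq1 => /eqP ->.
  exact: Conjugate1y.
- rewrite invey add0e => /eqP; rewrite inve_eq1 => /eqP ->.
  exact: Conjugatey1.
- by rewrite !invey adde0 => /eqP; rewrite eq_sym onee_eq0.
Qed.

Lemma conjugate_exponents_ge1 p q : conjugate_exponents p q ->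
  (1 <= p)%E /\ (1 <= q)%E.
Proof.
by case=> [||r r' r1 r'1 _]; rewrite ?lexx ?leey// !lee_fin !ltW.
Qed.

Lemma lpnorm1E d (x : 'cV[R]_d) : lpnorm 1%E x = \sum_j `|x j 0|.
Proof.
rewrite /= invr1 powRr1; last by apply: sumr_ge0 => *; exact: powR_ge0.
by apply: eq_bigr => j _; rewrite powRr1.
Qed.

Lemma lpnorm_powR r d (x : 'cV[R]_d) : r != 0 ->
  lpnorm r%:E x `^ r = \sum_j `|x j 0| `^ r.
Proof.
move=> r0; rewrite /= -powRrM mulVf// powRr1//.
by apply: sumr_ge0 => *; exact: powR_ge0.
Qed.

(** At the endpoint exponents one factor is bounded by 1 termwise; otherwise Young's inequality is
    summed. *)
Lemma hoelder_lpnorm_le1 p q d (x y : 'cV[R]_d) : conjugate_exponents p q ->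
  lpnorm p x <= 1 -> lpnorm q y <= 1 -> \sum_j x j 0 * y j 0 <= 1.
Proof.
move=> pq.
have xy : \sum_j x j 0 * y j 0 <= \sum_j `|x j 0| * `|y j 0|.
  by apply: ler_sum => j _; rewrite -normrM ler_norm.
have maxle1 (z : 'cV[R]_d) j : lpnorm +oo%E z <= 1 -> `|z j 0| <= 1.
  by apply: le_trans; exact: (le_bigmax _ (fun j => `|z j 0|)).
case: pq => [||r r' r1 r'1 rr'] x1 y1; apply: (le_trans xy).
- rewrite lpnorm1E in x1; apply: le_trans x1.
  by apply: ler_sum => j _; rewrite ler_piMr// maxle1.
- rewrite lpnorm1E in y1; apply: le_trans y1.
  by apply: ler_sum => j _; rewrite ler_piMl// maxle1.
have r0 : 0 < r := lt_trans ltr01 r1.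
have r'0 : 0 < r' := lt_trans ltr01 r'1.
have le1 (u : R) (z : 'cV[R]_d) : 0 < u -> lpnorm u%:E z <= 1 ->
    \sum_j `|z j 0| `^ u <= 1.
  move=> u0 zu; rewrite -lpnorm_powR ?gt_eqF//.
  have <- : 1 `^ u = 1 by rewrite powR1.
  by rewrite ge0_ler_powR ?nnegrE ?(ltW u0) ?ler01 ?lpnorm_ge0.
apply: (@le_trans _ _ (\sum_j (`|x j 0| `^ r / r + `|y j 0| `^ r' / r'))).
  by apply: ler_sum => j _; exact: conjugate_powR.
rewrite big_split/= -!mulr_suml -rr'.
apply: lerD; apply: ler_piMl.
- by rewrite invr_ge0 ltW.
- exact: le1 r0 x1.
- by rewrite invr_ge0 ltW.
- exact: le1 r'0 y1.
Qed.

(** Homogeneity reduces this to the unit balls; the scaling factors are the norms plus [e], hence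
    positive even when a norm is zero. *)
Lemma hoelder_lpnorm p q d (x y : 'cV[R]_d) : conjugate_exponents p q ->
  \sum_j x j 0 * y j 0 <= lpnorm p x * lpnorm q y.
Proof.
move=> pq; have [p1 q1] := conjugate_exponents_ge1 pq.
rewrite -[leRHS]add0r; apply: le_addM_eps; rewrite ?lpnorm_ge0// => e e0.
set a := lpnorm p x + e; set b := lpnorm q y + e.
have a0 : 0 < a by rewrite ltr_wpDl// lpnorm_ge0.
have b0 : 0 < b by rewrite ltr_wpDl// lpnorm_ge0.
have := @hoelder_lpnorm_le1 p q _ (a^-1 *: x) (b^-1 *: y) pq.
rewrite !lpnormZ// !gtr0_norm ?invr_gt0// !ler_pdivrMl// !mulr1.
rewrite !lerDl !(ltW e0) => /(_ isT isT).
under eq_bigr do rewrite !mxE mulrACA.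
rewrite -mulr_sumr -invfM ler_pdivrMl ?mulr_gt0// mulr1 => /le_trans; apply.
by rewrite add0r lerDr ltW.
Qed.

(** Equality case of Hoelder's inequality. The witness is the sign vector of [x] when [p] is 1, a
    signed unit vector at a largest coordinate when [p] is [+oo], and otherwise the gradient of the
    norm at [x]. *)
Lemma lpnorm_dual p q d (x : 'cV[R]_d) : conjugate_exponents p q ->
  exists2 y : 'cV[R]_d, lpnorm q y <= 1 & \sum_j x j 0 * y j 0 = lpnorm p x.
Proof.
move=> pq; have [p1 q1] := conjugate_exponents_ge1 pq.
have [x0|x0] := eqVneq (lpnorm p x) 0.
  exists 0; first by rewrite lpnorm0.
  by rewrite big1 ?x0// => j _; rewrite mxE mulr0.
have sgM (a : R) : a * Num.sg a = `|a| by rewrite mulrC normrEsg.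
case: pq x0 p1 q1 => [||r r' r1 r'1 rr'] x0 _ _.
- exists (map_mx Num.sg x).
    apply/bigmax_leP; split => // j _.
    by rewrite mxE normr_sg; case: eqP.
  by rewrite lpnorm1E; apply: eq_bigr => j _; rewrite mxE sgM.
- have [j xj] : exists j, `|x j 0| = lpnorm +oo%E x.
    (* The maximum is either attained at a coordinate or the default 0, which [x0] excludes. *)
    move: x0; rewrite /lpnorm; elim/big_ind : _ => [|u v hu hv|j _ _].
    + by rewrite eqxx.
    + by rewrite maxEle; case: ifP.
    + by exists j.
  exists (Num.sg (x j 0) *: delta_mx j 0).
    rewrite lpnormZ ?lexx// lpnorm1E (bigD1 j)//= big1 ?addr0 => [|i ij];
      last first.
      by rewrite mxE (negbTE ij) normr0.
    by rewrite mxE !eqxx normr1 mulr1 normr_sg; case: eqP.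
  rewrite (bigD1 j)//= big1 ?addr0 => [|i ij]; last first.
    by rewrite !mxE (negbTE ij) !mulr0.
  by rewrite !mxE !eqxx mulr1 sgM.
have r0 : 0 < r := lt_trans ltr01 r1.
have r'0 : 0 < r' := lt_trans ltr01 r'1.
have r0' : r != 0 by rewrite gt_eqF.
have r'0' : r' != 0 by rewrite gt_eqF.
have r10 : 0 < r - 1 by rewrite subr_gt0.
(* This identity turns the [r']-th powers of the witness's entries into |x_j|^r / A^r, which sum to
   1. *)
have rB : (r - 1) * r' = r.
  have : (r^-1 + r'^-1) * (r * r') = r * r' by rewrite rr' mul1r.
  have -> : (r^-1 + r'^-1) * (r * r') = r' + r.
    by field; rewrite r0' r'0'.
  by move=> h; rewrite mulrBl mul1r -h addrC addKr.
set A := lpnorm r%:E x in x0 *.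
have A0 : 0 < A by rewrite lt0r x0 lpnorm_ge0.
exists (\col_j (Num.sg (x j 0) * `|x j 0| `^ (r - 1) / A `^ (r - 1))).
  rewrite /=.
  have -> : \sum_j `|(\col_j0 (Num.sg (x j0 0) * `|x j0 0| `^ (r - 1) /
      A `^ (r - 1))) j 0| `^ r' = \sum_j (`|x j 0| `^ r) / A `^ r.
    apply: eq_bigr => j _; rewrite mxE !normrM.
    rewrite (ger0_norm (powR_ge0 _ _)) normfV (ger0_norm (powR_ge0 A _)).
    have [->|xj] := eqVneq (x j 0) 0.
      by rewrite sgr0 normr0 !mul0r !powR0// mul0r.
    rewrite normr_sg xj mul1r powRM ?invr_ge0 ?powR_ge0// -powRrM rB.
    by rewrite -(powRN A (r - 1)) -(powRrM A) mulNr rB powRN.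
  rewrite -mulr_suml -lpnorm_powR// -/A divff ?powR1//.
  by rewrite powR_eq0 negb_and x0.
under eq_bigr do rewrite mxE !mulrA sgM mulr_powRB1//.
rewrite -mulr_suml -lpnorm_powR// -/A// -(mulr_powRB1 (ltW A0) r0).
by rewrite mulfK// powR_eq0 negb_and x0.
Qed.

End lp.

(** * Weighted group norms over a partition and their duality *)

Section group_norm.
Context {R : realType} {d k : nat}.
Variable G : 'I_k -> {set 'I_d}.

Lemma subvectorZ a (x : 'cV[R]_d) (A : {set 'I_d}) :
  subvector (a *: x) A = a *: subvector x A.
Proof. by apply/colP => i; rewrite !mxE. Qed.

(** Exhibits the two nested norms, so that each l_p fact can be used twice: inside the groups and
    across them. *)
Lemma group_normE (alpha : 'cV[R]_k) p s (x : 'cV[R]_d) :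
  (forall i, 0 < alpha i 0) ->
  group_norm G alpha p s x =
  lpnorm s (\col_i (alpha i 0 * lpnorm p (subvector x (G i)))).
Proof.
move=> alpha0.
have ge0 i : 0 <= alpha i 0 * lpnorm p (subvector x (G i)).
  by rewrite mulr_ge0 ?lpnorm_ge0// ltW.
case: s => [r| |]//=.
  congr (_ `^ _); apply: eq_bigr => i _.
  by rewrite mxE ger0_norm// powRM ?lpnorm_ge0// ltW.
by apply: eq_bigr => i _; rewrite mxE ger0_norm.
Qed.

Section one_norm.
Variables (alpha : 'cV[R]_k) (p s : \bar R).
Hypotheses (alpha0 : forall i, 0 < alpha i 0) (p1 : (1 <= p)%E)
  (s1 : (1 <= s)%E).

Lemma group_norm_ge0 x : 0 <= group_norm G alpha p s x.
Proof. by rewrite group_normE// lpnorm_ge0. Qed.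

Lemma group_normZ a x :
  group_norm G alpha p s (a *: x) = `|a| * group_norm G alpha p s x.
Proof.
rewrite !group_normE// -lpnormZ//.
have -> : \col_i (alpha i 0 * lpnorm p (subvector (a *: x) (G i))) =
    `|a| *: \col_i (alpha i 0 * lpnorm p (subvector x (G i))).
  by apply/colP => i; rewrite !mxE subvectorZ lpnormZ// mulrCA.
by rewrite !lpnormZ// normr_id.
Qed.

End one_norm.

Hypothesis hG : is_indexed_partition G.

Lemma sum_indexed_partition (F : 'I_d -> R) :
  \sum_a F a = \sum_i \sum_(l < #|G i|) F (enum_val l).
Proof.
case: hG => _ disG coverG.
under [RHS]eq_bigr do rewrite -(big_enum_val F) big_mkcond/=.
rewrite exchange_big/=; apply: eq_bigr => a _.
have [i ai] := coverG a; rewrite (bigD1 i)//= ai big1 ?addr0// => j ji.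
by case: ifPn => // aj; have /disjointFl/(_ ai) := disG _ _ ji; rewrite aj.
Qed.

(** Since the groups are disjoint, at most one term of the double sum in the witness survives at
    each coordinate. *)
Lemma subvector_surj (w : forall i, 'cV[R]_#|G i|) :
  exists v : 'cV[R]_d, forall i, subvector v (G i) = w i.
Proof.
case: hG => _ disG _.
exists (\col_a \sum_i \sum_(l < #|G i|) w i l 0 * (a == enum_val l)%:R).
move=> i; apply/colP => l; rewrite !mxE (bigD1 i)//= [X in _ + X]big1.
  rewrite addr0 (bigD1 l)//= eqxx mulr1 big1 ?addr0// => m ml.
  by rewrite (inj_eq enum_val_inj) eq_sym (negbTE ml) mulr0.
move=> j ji; apply: big1 => m _; case: eqP; rewrite ?mulr0// => ij.
have /disjointFl/(_ (enum_valP l)) := disG _ _ ji.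
by rewrite ij enum_valP.
Qed.

Variables (alpha : 'cV[R]_k) (p q s t : \bar R).
Hypotheses (alpha0 : forall i, 0 < alpha i 0) (pq : conjugate_exponents p q)
  (st : conjugate_exponents s t).

Local Notation N := (group_norm G alpha p s).
Local Notation N' := (group_norm G (map_mx GRing.inv alpha) q t).

Let p1 := (conjugate_exponents_ge1 pq).1.
Let q1 := (conjugate_exponents_ge1 pq).2.
Let s1 := (conjugate_exponents_ge1 st).1.
Let t1 := (conjugate_exponents_ge1 st).2.

Lemma inv_weight_gt0 i : 0 < map_mx GRing.inv alpha i 0.
Proof. by rewrite mxE invr_gt0. Qed.

(** Hoelder inside each group, then across the groups; the weights of [N] and [N'] cancel in each
    product. *)
Lemma hoelder_group_norm (x y : 'cV[R]_d) : \sum_a x a 0 * y a 0 <= N x * N' y.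
Proof.
rewrite sum_indexed_partition !group_normE//; last exact: inv_weight_gt0.
apply: le_trans (hoelder_lpnorm _ _ st); apply: ler_sum => i _.
rewrite !mxE mulrACA divff ?gt_eqF// mul1r.
apply: le_trans (hoelder_lpnorm _ _ pq).
by apply: ler_sum => l _; rewrite !mxE.
Qed.

(** Dual vectors are chosen inside each group and, as [z], across the groups, then glued; the factor
    [alpha i 0] on group [i] cancels the inverse weight in [N']. *)
Lemma group_norm_dual (x : 'cV[R]_d) :
  exists2 v, N' v <= 1 & \sum_a x a 0 * v a 0 = N x.
Proof.
rewrite group_normE//.
have [z z1 xz] :=
  lpnorm_dual (\col_i (alpha i 0 * lpnorm p (subvector x (G i)))) st.
pose w i := cid2 (lpnorm_dual (subvector x (G i)) pq).
have [v vw] := subvector_surj (fun i => (alpha i 0 * z i 0) *: s2val (w i)).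
exists v.
  rewrite group_normE; last exact: inv_weight_gt0.
  apply: le_trans z1; apply: ler_lpnorm => // i; rewrite !mxE vw lpnormZ//.
  have w1 : lpnorm q (s2val (w i)) <= 1 := s2valP (w i).
  rewrite !normrM normr_id (ger0_norm (lpnorm_ge0 _ _)) normfV.
  rewrite !mulrA mulVf ?mul1r ?normr_eq0 ?gt_eqF//.
  by rewrite normr_id ler_piMr.
rewrite sum_indexed_partition -xz; apply: eq_bigr => i _.
rewrite !mxE -(s2valP' (w i)) mulrAC mulr_sumr; apply: eq_bigr => l _.
have := congr1 (fun y : 'cV[R]_#|G i| => y l 0) (vw i); rewrite !mxE => ->.
by rewrite mulrCA.
Qed.

(** By duality [N (x + y)] is the value at [x + y] of a linear functional that is bounded by [N]. *)
Lemma ler_group_normD x y : N (x + y) <= N x + N y.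
Proof.
have [v v1 <-] := group_norm_dual (x + y).
under eq_bigr do rewrite mxE mulrDl.
rewrite big_split/=; apply: lerD; apply: (le_trans (hoelder_group_norm _ _)).
  by rewrite ler_piMr// group_norm_ge0.
by rewrite ler_piMr// group_norm_ge0.
Qed.

Lemma group_norm_le_coord (x : 'cV[R]_d) :
  N x <= \sum_a `|x a 0| * N (delta_mx a 0).
Proof.
suff h (r : seq 'I_d) : N (\sum_(a <- r) x a 0 *: delta_mx a 0) <=
    \sum_(a <- r) `|x a 0| * N (delta_mx a 0).
  apply: le_trans (h _); rewrite le_eqVlt; apply/orP; left; apply/eqP.
  congr (group_norm _ _ _ _ _); rewrite {1}[x]matrix_sum_delta.
  by apply: eq_bigr => a _; rewrite big_ord1.
elim: r => [|a r ih].
  by rewrite !big_nil -(scale0r (0 : 'cV[R]_d)) group_normZ// normr0 mul0r.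
rewrite !big_cons; apply: (le_trans (ler_group_normD _ _)).
by rewrite group_normZ// lerD2l.
Qed.

(** Hoelder's inequality against a unit vector; this supplies the coercivity of [N]. *)
Lemma coord_le_group_norm (x : 'cV[R]_d) a :
  `|x a 0| <= N x * N' (delta_mx a 0).
Proof.
have h (y : 'cV[R]_d) : y a 0 <= N y * N' (delta_mx a 0).
  apply: le_trans (hoelder_group_norm _ _).
  rewrite (bigD1 a)//= mxE !eqxx mulr1 big1 ?addr0// => i ia.
  by rewrite mxE (negbTE ia) mulr0.
rewrite ler_norml h andbT lerNl.
by have := h ((-1) *: x); rewrite group_normZ// normrN1 mul1r mxE mulN1r.
Qed.

End group_norm.

(** * Continuity criteria for the two terms of the objective *)

Lemma continuous_sum (R : realType) (T : topologicalType) m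
    (f : 'I_m -> T -> R) :
  (forall i, continuous (f i)) -> continuous (fun x => \sum_i f i x).
Proof.
move=> cf; apply: continuous_big => //.
by move=> x; apply: (@add_continuous R^o).
Qed.

(** A one-sided bound is enough: exchanging [u] and [v] gives the other side, and [F] is
    squeezed. *)
Lemma lipschitz_coord_continuous (R : realType) (T : topologicalType) m
    (f : 'I_m -> T -> R) (c : 'I_m -> R) (F : T -> R) :
  (forall i, continuous (f i)) ->
  (forall u v, F v <= F u + \sum_i `|f i u - f i v| * c i) -> continuous F.
Proof.
move=> cf hF u.
pose g v := \sum_i `|f i u - f i v| * c i.
have cg : g v @[v --> u] --> (0 : R).
  have -> : (0 : R) = g u.
    by rewrite /g big1// => i _; rewrite subrr normr0 mul0r.
  apply: continuous_sum => i v.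
  apply: cvgMr_tmp; apply: cvg_norm; apply: cvgB; first exact: cvg_cst.
  exact: cf.
apply: (@squeeze_cvgr _ _ _ _ (fun v => F u - g v) (fun v => F u + g v)).
- near=> v; rewrite hF andbT lerBlDr; apply: le_trans (hF v u) _.
  by rewrite lerD2l; apply: ler_sum => i _; rewrite distrC.
- by rewrite -[X in _ --> X]subr0; apply: cvgB; [exact: cvg_cst|].
- by rewrite -[X in _ --> X]addr0; apply: cvgD; [exact: cvg_cst|].
Unshelve. all: by end_near.
Qed.

Lemma continuousD_scale (R : realType) (T : topologicalType) (F H : T -> R) c :
  continuous F -> continuous H -> continuous (fun x => F x + c * H x).
Proof.
by move=> cF cH u; apply: cvgD; [exact: cF|apply: cvgMl_tmp; exact: cH].
Qed.

Lemma rms_affine_continuous (R : realType) (T : topologicalType) m n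
    (f : 'I_m -> T -> R) (c : R) (x : 'I_n -> 'I_m -> R) (y : 'I_n -> R) :
  (forall a, continuous (f a)) ->
  continuous (fun u =>
    Num.sqrt (c * \sum_i (y i - \sum_a x i a * f a u) ^+ 2)).
Proof.
move=> cf u.
apply: (@continuous_comp _ _ _ (fun u =>
  c * \sum_i (y i - \sum_a x i a * f a u) ^+ 2) Num.sqrt); last first.
  exact: sqrt_continuous.
apply: cvgMl_tmp; move: u; apply: continuous_sum => i u.
apply: (@continuous_comp _ _ _ (fun u => y i - \sum_a x i a * f a u)
  (fun z : R => z ^+ 2)); last exact: exprn_continuous.
apply: cvgB; first exact: cvg_cst.
move: u; apply: continuous_sum => a u.
by apply: cvgMl_tmp; exact: cf.
Qed.

(** * Existence of a minimizer of the penalized objective *)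

Section minimum.
Context {R : realType} {d k : nat}.
Variables (G : 'I_k -> {set 'I_d}) (alpha : 'cV[R]_k) (p q s t : \bar R).
Hypotheses (hG : is_indexed_partition G) (alpha0 : forall i, 0 < alpha i 0)
  (pq : conjugate_exponents p q) (st : conjugate_exponents s t).

Local Notation N := (group_norm G alpha p s).
Local Notation N' := (group_norm G (map_mx GRing.inv alpha) q t).

Let p1 := (conjugate_exponents_ge1 pq).1.
Let q1 := (conjugate_exponents_ge1 pq).2.
Let s1 := (conjugate_exponents_ge1 st).1.
Let t1 := (conjugate_exponents_ge1 st).2.

(** Stated on row vectors, for which compactness of boxes and the extreme value theorem are invoked
    below. *)
Lemma group_norm_trmx_continuous : continuous (fun u : 'rV[R]_d => N u^T).
Proof.
apply: (@lipschitz_coord_continuous _ _ _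
  (fun a (u : 'rV[R]_d) => u 0 a) (fun a => N (delta_mx a 0))).
  by move=> a; exact: coord_continuous.
move=> u v; rewrite -{1}[v](subrKC u) linearD/=.
apply: (le_trans (ler_group_normD hG alpha0 pq st _ _)); rewrite lerD2l.
apply: (le_trans (group_norm_le_coord hG alpha0 pq st _)).
by apply: ler_sum => a _; rewrite !mxE distrC.
Qed.

Lemma penalized_minimum (F : 'cV[R]_d -> R) (c : R) : 0 < c ->
  (forall b, 0 <= F b) -> continuous (fun u : 'rV[R]_d => F u^T) ->
  exists b, forall x, F b + c * N b <= F x + c * N x.
Proof.
move=> c0 F0 cF; pose f (u : 'rV[R]_d) := F u^T + c * N u^T.
have cf : continuous f.
  exact: continuousD_scale cF group_norm_trmx_continuous.
(* Half-widths chosen so that, by [coord_le_group_norm], a coordinate larger than [M a] forces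
   [c * N x] above [f 0]. *)
pose M a := f 0 / c * N' (delta_mx a 0).
have M0 a : 0 <= M a.
  rewrite mulr_ge0 ?group_norm_ge0//; last exact: inv_weight_gt0.
  by rewrite divr_ge0 ?(ltW c0)// addr_ge0// mulr_ge0 ?(ltW c0) ?group_norm_ge0.
pose A := [set u : 'rV[R]_d | forall a, `[- M a, M a]%classic (u 0 a)].
have A0 : A 0 by move=> a /=; rewrite mxE in_itv/= oppr_le0 M0.
have cA : compact A by apply: (rV_compact (fun a => @segment_compact R _ _)).
have [b bA bmin] := EVT_min_rV (ex_intro _ _ A0) cA (continuous_subspaceT cf).
exists b^T => x; have [xA|xA] := pselect (A x^T).
  by have := bmin x^T; rewrite /f trmxK; apply; rewrite inE.
(* Outside the box [A] the penalty alone exceeds [f 0]. *)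
apply: (@le_trans _ _ (f 0)); first by apply: bmin; rewrite inE.
have [a xa] : exists a, M a < `|x a 0|.
  apply/not_existsP => h; apply: xA => a /=; rewrite mxE in_itv/= -ler_norml.
  by rewrite leNgt; apply/negP; exact: h.
have := lt_le_trans xa (coord_le_group_norm hG alpha0 pq st x a).
(* If this dual norm vanished, both sides of the strict inequality just obtained would be 0. *)
have [N'0|] := ltP 0 (N' (delta_mx a 0)); last first.
  move=> N'0; rewrite /M; have -> : N' (delta_mx a 0) = 0.
    apply/eqP; rewrite eq_le N'0 group_norm_ge0//; exact: inv_weight_gt0.
  by rewrite !mulr0 ltxx.
rewrite ltr_pM2r// ltr_pdivrMr// mulrC => /ltW fN.
by apply: (le_trans fN); rewrite lerDr.
Qed.

End minimum.

(** * Integrals of nonnegative functions under marginals and empirical measures *)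

Section integrals.
Context d (T : measurableType d) (R : realType).
Local Open Scope ereal_scope.
Import HBNNSimple.

(* The integral of a nonnegative function is a supremum over the simple
   functions below it, hence monotone without measurability; this avoids
   proving that the transport cost is measurable. *)
Lemma le_integral_nonmeasurable (mu : {measure set T -> \bar R})
    (f g : T -> \bar R) :
  (forall x, 0 <= f x) -> (forall x, f x <= g x) ->
  \int[mu]_x f x <= \int[mu]_x g x.
Proof.
move=> f0 fg; rewrite !ge0_integralTE => [|x|//]; last exact: le_trans (fg x).
by apply: ereal_sup_le => _ [h hf <-]; exists h => // x; exact: le_trans (fg x).
Qed.

(** Change of variables for an image measure; with the projections as [phi], it relates integrals
    under a coupling and under its marginals. *)
Lemma integral_marginal d' (T' : measurableType d') (phi : T -> T')
    (pi : {measure set T -> \bar R}) (P : {measure set T' -> \bar R})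
    (f : T' -> \bar R) :
  measurable_fun setT phi ->
  (forall A, measurable A -> pi (phi @^-1` A) = P A) ->
  measurable_fun setT f -> (forall y, 0 <= f y) ->
  \int[P]_y f y = \int[pi]_x f (phi x).
Proof.
move=> mphi piP mf f0.
rewrite -[RHS](@ge0_integral_pushforward _ _ _ _ _ _ mphi pi setT)//.
by apply: eq_measure_integral => A mA _; rewrite -piP.
Qed.

Section empirical_integral.
Variables (n : nat) (Z : 'I_n.+1 -> T).

Lemma integral_empirical (f : T -> \bar R) :
  measurable_fun setT f -> (forall x, 0 <= f x) ->
  \int[empirical Z]_x f x = ((n.+1%:R : R)^-1)%:E * \sum_i f (Z i).
Proof.
move=> mf f0.
have c0 : (0 <= (n.+1%:R : R)^-1)%R by [].
rewrite (eq_measure_integral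
  (mscale (NngNum c0) (msum (fun i => \d_(Z (inord i))) n.+1))).
  rewrite ge0_integral_mscale// ge0_integral_measure_sum//; congr (_ * _).
  by apply: eq_bigr => i _; rewrite integral_dirac// diracT mul1e inord_val.
move=> A mA _; rewrite /empirical /mscale /msum/=; congr (_ * _).
by apply: eq_bigr => i _; rewrite inord_val.
Qed.

(** Meant for the transport cost: [integral_empirical] is applied to the simple functions below [f],
    which are measurable. *)
Lemma le_integral_empirical (f : T -> \bar R) : (forall x, 0 <= f x) ->
  \int[empirical Z]_x f x <= ((n.+1%:R : R)^-1)%:E * \sum_i f (Z i).
Proof.
move=> f0; rewrite ge0_integralTE//; apply: ge_ereal_sup => _ [h hf <-].
rewrite -integralT_nnsfun integral_empirical//; last 2 first.
  - exact/measurable_EFinP.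
  - by move=> x; rewrite lee_fin.
by apply: lee_wpmul2l; [rewrite lee_fin|exact: lee_sum].
Qed.

End empirical_integral.
End integrals.

(** * Measurability and expectation of the squared loss *)

Section data_space.
Context {R : realType} {d : nat}.

Lemma continuous_measurable_data (h : 'cV[R]_d * R -> R) :
  continuous h ->
  measurable_fun [set: data_space R d] (h : data_space R d -> R).
Proof.
move=> /continuousP ch; apply: (measurability _ (RGenOpens.measurableE R)).
move=> _ [_ [a [b ->] <-]]; rewrite setTI; apply: sub_sigma_algebra.
exact/ch/interval_open.
Qed.

Definition residual (b : 'cV[R]_d) (z : data_space R d) : R :=
  z.2 - (z.1^T *m b) 0 0.

Lemma residualE (b : 'cV[R]_d) z : residual b z = z.2 - \sum_a z.1 a 0 * b a 0.
Proof. by rewrite /residual mxE; under eq_bigr do rewrite mxE. Qed.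

Lemma squared_lossE (b : 'cV[R]_d) z : squared_loss b z = residual b z ^+ 2.
Proof. by []. Qed.

Lemma measurable_residual (b : 'cV[R]_d) : measurable_fun setT (residual b).
Proof.
apply: continuous_measurable_data => z.
rewrite (_ : residual b = fun z => z.2 - \sum_a z.1 a 0 * b a 0); last first.
  by apply/funext => w; rewrite residualE.
apply: cvgB; first exact: cvg_snd.
move: z; apply: continuous_sum => a w.
apply: cvgMr_tmp.
apply: (@continuous_comp _ _ _ fst (fun x : 'cV[R]_d => x a 0)).
  exact: cvg_fst.
exact: coord_continuous.
Qed.

Lemma measurable_squared_loss (b : 'cV[R]_d) :
  measurable_fun setT (squared_loss b).
Proof. by apply: measurable_funX; exact: measurable_residual. Qed.

Lemma expectation_squared_loss (P : probability (data_space R d) R)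
    (b : 'cV[R]_d) :
  ('E_P[squared_loss b] = \int[P]_z (squared_loss b z)%:E)%E.
Proof. by rewrite unlock. Qed.

Definition mean_squared_loss n (Z : 'I_n.+1 -> data_space R d)
    (b : 'cV[R]_d) : R :=
  n.+1%:R^-1 * \sum_i squared_loss b (Z i).

Lemma mean_squared_loss_ge0 n (Z : 'I_n.+1 -> data_space R d) (b : 'cV[R]_d) :
  0 <= mean_squared_loss Z b.
Proof. by rewrite mulr_ge0// sumr_ge0// => i _; exact: sqr_ge0. Qed.

Lemma expectation_empirical n (Z : 'I_n.+1 -> data_space R d) (b : 'cV[R]_d) :
  ('E_(empirical Z)[squared_loss b] = (mean_squared_loss Z b)%:E)%E.
Proof.
rewrite expectation_squared_loss integral_empirical.
- by rewrite sumEFin -EFinM.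
- by apply/measurable_EFinP; exact: measurable_squared_loss.
- by move=> z; rewrite lee_fin sqr_ge0.
Qed.

End data_space.

(** * Mass and support of empirical measures *)

Section empirical_support.
Context {disp : measure_display} {T : measurableType disp} {R : realType}.
Variables (n : nat) (Z : 'I_n.+1 -> T).
Local Open Scope ereal_scope.

(** Computed from the Dirac masses, so that it applies to a product of supports without a proof that
    this set is measurable. *)
Lemma empirical_eq1 (A : set T) : (forall i, A (Z i)) ->
  empirical Z A = 1 :> \bar R.
Proof.
move=> AZ; rewrite -(probability_setT (empirical Z : probability T R)).
rewrite /empirical; congr (_ * _); apply: eq_bigr => i _.
by rewrite !diracE !mem_set.
Qed.

Lemma empirical_gt0 (A : set T) i : A (Z i) -> 0 < empirical Z A :> \bar R.
Proof.
move=> AZ; rewrite /empirical mule_gt0 ?lte_fin ?invr_gt0 ?ltr0n//.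
rewrite (bigD1 i)//= diracE (mem_set AZ).
by rewrite (lt_le_trans lte01)// leeDl// sume_ge0.
Qed.

End empirical_support.

(** * The worst-case loss at a fixed coefficient vector *)

Section robust_loss.
Context {R : realType} {d k : nat}.
Variables (G : 'I_k -> {set 'I_d}) (alpha : 'cV[R]_k) (p q s t : \bar R).
Hypotheses (hG : is_indexed_partition G) (alpha0 : forall i, 0 < alpha i 0)
  (pq : conjugate_exponents p q) (st : conjugate_exponents s t).

Local Notation E := (data_space R d).
Local Notation N := (group_norm G alpha p s).
Local Notation N' := (group_norm G (map_mx GRing.inv alpha) q t).
Local Notation cost := (transport_cost G alpha q t).

Let p1 := (conjugate_exponents_ge1 pq).1.
Let q1 := (conjugate_exponents_ge1 pq).2.
Let s1 := (conjugate_exponents_ge1 st).1.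
Let t1 := (conjugate_exponents_ge1 st).2.

(* [M] is kept positive, even when [N b = 0], because the cost may be infinite
   and [0 * +oo = 0]. *)
Lemma residual_sub_cost (b : 'cV[R]_d) (u w : E) (M : R) :
  0 < M -> N b ^+ 2 <= M ->
  (((residual b u - residual b w) ^+ 2 / M)%:E <= cost u w)%E.
Proof.
move=> M0 NM; rewrite /transport_cost; case: eqP => [uw|_]; last exact: leey.
rewrite lee_fin ler_pdivrMr//.
have -> : residual b u - residual b w = - \sum_a b a 0 * (u.1 - w.1) a 0.
  rewrite !residualE uw opprB addrC addrA subrK.
  rewrite -sumrB -sumrN; apply: eq_bigr => a _; rewrite !mxE; ring.
rewrite sqrrN -[leLHS]real_normK ?num_real//.
apply: (@le_trans _ _ ((N b * N' (u.1 - w.1)) ^+ 2)).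
  apply: lerXn2r; rewrite ?nnegrE//.
    by rewrite mulr_ge0 ?group_norm_ge0//; exact: inv_weight_gt0.
  rewrite ler_norml (hoelder_group_norm hG alpha0 pq st) andbT lerNl.
  have := hoelder_group_norm hG alpha0 pq st b ((-1) *: (u.1 - w.1)).
  rewrite group_normZ//; last exact: inv_weight_gt0.
  rewrite normrN1 mul1r; apply: le_trans.
  by rewrite -sumrN le_eqVlt; apply/orP; left; apply/eqP/eq_bigr => a _;
    rewrite [in RHS]mxE mulN1r mulrN.
by rewrite exprMn mulrC ler_wpM2l ?sqr_ge0.
Qed.

(* Replaces Minkowski's inequality: optimizing over [l] after integration gives
   the squared sum of the L2 norms. *)
Lemma sqr_weighted (x y l : R) : 0 < l ->
  x ^+ 2 <= (1 + l) * y ^+ 2 + (1 + l^-1) * (x - y) ^+ 2.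
Proof.
move=> l0; rewrite -subr_ge0.
have -> : (1 + l) * y ^+ 2 + (1 + l^-1) * (x - y) ^+ 2 - x ^+ 2 =
    (l * y - (x - y)) ^+ 2 / l by field; rewrite gt_eqF.
by rewrite divr_ge0 ?sqr_ge0 ?ltW.
Qed.

Section data.
Variables (n : nat) (Z : 'I_n.+1 -> E).
Local Notation Pn := (empirical Z : probability E R).

(** Integrates [sqr_weighted] at the two residuals: the second marginal yields the empirical loss,
    and [residual_sub_cost] controls the squared difference. The weight [l] is left free, to be
    optimized. *)
Lemma coupling_upper_bound (b : 'cV[R]_d) (P : probability E R)
    (pi : probability (E * E)%type R) (M D l : R) :
  couplings P Pn pi -> 0 < M -> N b ^+ 2 <= M -> 0 < l ->
  (\int[pi]_z cost z.1 z.2 <= D%:E)%E ->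
  ('E_P[squared_loss b] <=
   ((1 + l) * mean_squared_loss Z b + (1 + l^-1) * M * D)%:E)%E.
Proof.
move=> [_ pi1 pi2] M0 NM l0 piD.
have mfst := @measurable_fst _ _ E E.
have msnd := @measurable_snd _ _ E E.
have ml : measurable_fun [set: E] (fun z => (squared_loss b z)%:E).
  by apply/measurable_EFinP; exact: measurable_squared_loss.
have l_ge0 (z : E) : (0 <= (squared_loss b z)%:E)%E by rewrite lee_fin sqr_ge0.
(* A measurable minorant of the cost, to which additivity of the integral applies. *)
pose H (z : E * E) := (residual b z.1 - residual b z.2) ^+ 2 / M.
have mH : measurable_fun [set: E * E] H.
  apply: measurable_funM => //; apply: measurable_funX.
  by apply: measurable_funB; apply: measurableT_comp => //;
    exact: measurable_residual.
have H0 z : (0 <= (H z)%:E)%E by rewrite lee_fin divr_ge0 ?sqr_ge0 ?(ltW M0).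
have HD : (\int[pi]_z (H z)%:E <= D%:E)%E.
  apply: le_trans piD; apply: le_integral_nonmeasurable => // z.
  exact: residual_sub_cost.
rewrite expectation_squared_loss (integral_marginal mfst pi1 ml l_ge0).
have l1 : 0 <= 1 + l by rewrite addr_ge0 ?(ltW l0).
have l1' : 0 <= (1 + l^-1) * M.
  by rewrite mulr_ge0 ?(ltW M0)// addr_ge0// invr_ge0 ltW.
apply: (@le_trans _ _ (\int[pi]_z ((1 + l)%:E * (squared_loss b z.2)%:E
    + ((1 + l^-1) * M)%:E * (H z)%:E))%E).
  apply: le_integral_nonmeasurable => // z.
  rewrite -!EFinM -EFinD lee_fin !squared_lossE.
  have -> : (1 + l^-1) * M * H z =
      (1 + l^-1) * (residual b z.1 - residual b z.2) ^+ 2.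
    by rewrite /H mulrA mulrAC mulfK// gt_eqF.
  exact: sqr_weighted.
have ml2 : measurable_fun [set: E * E] (fun z => (squared_loss b z.2)%:E).
  exact: (measurableT_comp ml).
have mHE : measurable_fun [set: E * E] (fun z => (H z)%:E).
  exact/measurable_EFinP.
rewrite ge0_integralD//; first last.
- exact: measurable_funeM.
- by move=> z _; rewrite mule_ge0// lee_fin.
- exact: measurable_funeM.
- by move=> z _; rewrite mule_ge0// lee_fin.
rewrite !ge0_integralZl ?lee_fin//.
rewrite -(integral_marginal msnd pi2 ml l_ge0) -expectation_squared_loss.
rewrite expectation_empirical [leRHS]EFinD -EFinM leeD2l//.
by rewrite [leRHS]EFinM lee_wpmul2l// lee_fin.
Qed.

Lemma worst_case_upper_bound (b : 'cV[R]_d) (P : probability E R) delta :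
  0 <= delta -> (ot_discrepancy cost P Pn <= delta%:E)%E ->
  (sqrte 'E_P[squared_loss b] <=
   (Num.sqrt (mean_squared_loss Z b) + Num.sqrt delta * N b)%:E)%E.
Proof.
move=> delta0 Pdelta; set A := mean_squared_loss Z b.
have A0 : 0 <= A := mean_squared_loss_ge0 Z b.
have bound e : 0 < e -> ('E_P[squared_loss b] <=
    ((Num.sqrt A + e + (Num.sqrt delta + e) * (N b + e)) ^+ 2)%:E)%E.
  move=> e0; set a := Num.sqrt A + e.
  set sd := Num.sqrt delta + e; set m := N b + e.
  have a0 : 0 < a by rewrite ltr_wpDl// sqrtr_ge0.
  have sd0 : 0 < sd by rewrite ltr_wpDl// sqrtr_ge0.
  have m0 : 0 < m by rewrite ltr_wpDl// group_norm_ge0.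
  (* The infimum may not be attained; the strict inequality provides an actual coupling. *)
  have : (ot_discrepancy cost P Pn < (sd ^+ 2)%:E)%E.
    apply: (le_lt_trans Pdelta); rewrite lte_fin -[ltLHS]sqr_sqrtr//.
    by rewrite ltrXn2r// ?nnegrE ?sqrtr_ge0 ?(ltW sd0)// ltrDl.
  move=> /ereal_inf_lt[_ [pi piP <-] /ltW pisd].
  have Nm : N b ^+ 2 <= m ^+ 2.
    by rewrite lerXn2r ?nnegrE ?group_norm_ge0 ?(ltW m0)// lerDl ltW.
  (* This weight minimizes (1 + l) a^2 + (1 + 1/l) m^2 sd^2 over l > 0, with minimum (a + sd
     m)^2. *)
  have l0 : 0 < sd * m / a by rewrite divr_gt0 ?mulr_gt0.
  have := coupling_upper_bound piP (exprn_gt0 2 m0) Nm l0 pisd.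
  move=> /le_trans; apply; rewrite lee_fin -/A.
  have Aa : A <= a ^+ 2.
    rewrite -[leLHS]sqr_sqrtr// lerXn2r ?nnegrE ?sqrtr_ge0 ?(ltW a0)//.
    by rewrite lerDl ltW.
  have -> : (a + sd * m) ^+ 2 = (1 + sd * m / a) * a ^+ 2
      + (1 + (sd * m / a)^-1) * m ^+ 2 * sd ^+ 2.
    by field; rewrite !gt_eqF.
  by rewrite lerD2r ler_wpM2l// addr_ge0// ltW.
have E0 : (0 <= 'E_P[squared_loss b])%E.
  by apply: expectation_ge0 => z; exact: sqr_ge0.
(* An infinite expectation already contradicts the bound at [e = 1]. *)
case: ('E_P[squared_loss b])%E E0 bound => [V||//] /= V0 bound; last first.
  by have := bound 1 ltr01; rewrite leye_eq.
rewrite lee_fin; apply: le_addM_eps => [||e e0].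
- exact: sqrtr_ge0.
- exact: group_norm_ge0.
have := bound _ e0; rewrite lee_fin => Ve.
have B0 : 0 <= Num.sqrt A + e + (Num.sqrt delta + e) * (N b + e).
  have e0' := ltW e0.
  by rewrite !(addr_ge0, mulr_ge0) ?sqrtr_ge0 ?group_norm_ge0.
by rewrite -[leRHS]ger0_norm// -sqrtr_sqr ler_sqrt// sqr_ge0.
Qed.

(** Equality in Minkowski's inequality asks for [kappa] proportional to [r]: the ratio has absolute
    value sqrt(delta) / sqrt(A), giving mean square [delta], and is negative so that the two terms
    add up. *)
Lemma optimal_shift (r : 'I_n.+1 -> R) (delta m : R) : 0 <= delta ->
  let A := n.+1%:R^-1 * \sum_i r i ^+ 2 in
  exists kappa : 'I_n.+1 -> R,
    n.+1%:R^-1 * \sum_i kappa i ^+ 2 = delta /\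
    n.+1%:R^-1 * \sum_i (r i - kappa i * m) ^+ 2 =
      (Num.sqrt A + Num.sqrt delta * m) ^+ 2.
Proof.
move=> delta0 A; have n0 : n.+1%:R != 0 :> R by rewrite pnatr_eq0.
have A0 : 0 <= A by rewrite mulr_ge0// sumr_ge0// => i _; exact: sqr_ge0.
have [Az|Anz] := eqVneq A 0.
  have r0 i : r i = 0.
    apply/eqP; rewrite -sqrf_eq0; apply/eqP.
    have /eqP := Az; rewrite mulf_eq0 invr_eq0 (negbTE n0)/= => /eqP.
    by move/psumr_eq0P; apply => // j _; exact: sqr_ge0.
  (* When every [r i] is 0, a constant shift attains the value. *)
  exists (fun=> Num.sqrt delta); rewrite Az sqrtr0 add0r.
  under [in X in _ /\ X]eq_bigr do rewrite r0 sub0r sqrrN.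
  rewrite !sumr_const card_ord -[X in _ * X = delta]mulr_natl mulKf//.
  by rewrite -[X in _ * X = _]mulr_natl mulKf// sqr_sqrtr.
have sA0 : Num.sqrt A != 0 by rewrite sqrtr_eq0 -ltNge lt0r Anz.
exists (fun i => - (Num.sqrt delta / Num.sqrt A) * r i); split.
  under eq_bigr do rewrite exprMn.
  rewrite -mulr_sumr mulrCA -/A sqrrN exprMn exprVn !sqr_sqrtr//.
  by rewrite divfK.
under eq_bigr => i _.
  have -> : r i - - (Num.sqrt delta / Num.sqrt A) * r i * m =
    (1 + Num.sqrt delta / Num.sqrt A * m) * r i by ring.
  rewrite exprMn; over.
rewrite -mulr_sumr mulrCA -/A -[X in _ * X](sqr_sqrtr A0) -exprMn.
by congr (_ ^+ 2); field.
Qed.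

Lemma empirical_support (W : 'I_n.+1 -> E) i :
  Defs.support (empirical W : probability E R) (W i).
Proof.
by move=> U _ UW; exact: (@empirical_gt0 _ E R n W U i UW).
Qed.

Lemma worst_case_attained (b : 'cV[R]_d) delta : 0 <= delta ->
  exists2 P : probability E R, (ot_discrepancy cost P Pn <= delta%:E)%E &
    sqrte 'E_P[squared_loss b] =
    (Num.sqrt (mean_squared_loss Z b) + Num.sqrt delta * N b)%:E.
Proof.
move=> delta0.
have [v v1 bv] := group_norm_dual hG alpha0 pq st b.
have [kappa [kd kr]] :=
  optimal_shift (fun i => residual b (Z i)) (N b) delta0.
(* Only the first component moves: equal responses keep the cost finite, and [N' v <= 1] bounds it
   by [kappa i ^+ 2]. *)
pose W i : E := ((Z i).1 + kappa i *: v, (Z i).2).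
exists (empirical W).
  have kdE : (((n.+1%:R : R)^-1)%:E * \sum_i (kappa i ^+ 2)%:E = delta%:E)%E.
    by rewrite sumEFin -EFinM kd.
  rewrite -kdE.
  (* The coupling matches each shifted point with its origin. *)
  apply: (@le_trans _ _ (\int[empirical (fun i => (W i, Z i) : (E * E)%type)]_z
      cost z.1 z.2)%E).
    apply: ereal_inf_lbound; exists (empirical (fun i => (W i, Z i))) => //.
    split => //.
    by apply: empirical_eq1 => i; split; exact: empirical_support.
  have cost0 u w : (0 <= cost u w)%E.
    by rewrite /transport_cost; case: ifP => // _; rewrite lee_fin sqr_ge0.
  apply: (le_trans (le_integral_empirical _ _)) => //.
  apply: lee_wpmul2l; first by rewrite lee_fin.
  apply: lee_sum => i _; rewrite /transport_cost eqxx lee_fin/=.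
  rewrite addrC addKr group_normZ//; last exact: inv_weight_gt0.
  rewrite exprMn real_normK ?num_real// ler_piMr ?sqr_ge0//.
  rewrite -(expr1n _ 2) lerXn2r ?nnegrE ?group_norm_ge0//.
  exact: inv_weight_gt0.
rewrite expectation_empirical /= -[RHS]/(EFin _); congr EFin.
have -> : mean_squared_loss W b =
    (Num.sqrt (mean_squared_loss Z b) + Num.sqrt delta * N b) ^+ 2.
  rewrite -kr /mean_squared_loss; congr (_ * _); apply: eq_bigr => i _.
  rewrite squared_lossE !residualE /= -bv mulr_sumr; congr (_ ^+ 2).
  rewrite -addrA -opprD -big_split/=; congr (_ - _).
  by apply: eq_bigr => a _; rewrite !mxE; ring.
rewrite sqrtr_sqr ger0_norm// addr_ge0 ?sqrtr_ge0// mulr_ge0 ?sqrtr_ge0//.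
exact: group_norm_ge0.
Qed.

Lemma worst_case_loss (b : 'cV[R]_d) delta : 0 <= delta ->
  ereal_sup [set sqrte 'E_P[squared_loss b] |
    P in [set P : probability E R | (ot_discrepancy cost P Pn <= delta%:E)%E]] =
  (Num.sqrt (mean_squared_loss Z b) + Num.sqrt delta * N b)%:E.
Proof.
move=> delta0; apply/eqP; rewrite eq_le; apply/andP; split.
  by apply: ge_ereal_sup => _ [P Pdelta <-]; exact: worst_case_upper_bound.
have [P Pdelta <-] := worst_case_attained b delta0.
by apply: ereal_sup_ubound; exists P.
Qed.

End data.
End robust_loss.

Theorem theorem1 (R : realType) (d n k : nat)
    (X : 'I_n.+1 -> 'cV[R]_d) (Y : 'I_n.+1 -> R)
    (G : 'I_k -> {set 'I_d}) (alpha : 'cV[R]_k) (p q s t : \bar R) (delta : R)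
    (hG : is_indexed_partition G)
    (halpha : forall i, 0 < alpha i 0)
    (hp : (1 <= p)%E) (hq : (1 <= q)%E) (hs : (1 <= s)%E) (ht : (1 <= t)%E)
    (hpq : (p^-1 + q^-1 = 1)%E) (hst : (s^-1 + t^-1 = 1)%E)
    (hdelta : 0 < delta) :
  let Pn : probability (data_space R d) R :=
    empirical (fun i => (X i, Y i) : data_space R d) in
  exists v : \bar R,
    is_minimum (fun beta : 'cV[R]_d =>
      ereal_sup [set sqrte 'E_P[squared_loss beta] |
        P in [set P : probability (data_space R d) R |
          (ot_discrepancy (transport_cost G alpha q t) P Pn <= delta%:E)%E]]) v
    /\
    is_minimum (fun beta : 'cV[R]_d =>
      sqrte 'E_Pn[squared_loss beta]
        + (Num.sqrt delta * group_norm G alpha p s beta)%:E)%E v.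
Proof.
move=> Pn; set Z : 'I_n.+1 -> data_space R d := fun i => (X i, Y i).
have pq := conjugate_exponentsP hp hq hpq.
have st := conjugate_exponentsP hs ht hst.
pose F (b : 'cV[R]_d) := Num.sqrt (mean_squared_loss Z b).
have cF : continuous (fun u : 'rV[R]_d => F u^T).
  rewrite (_ : (fun _ => _) = fun u : 'rV[R]_d => Num.sqrt (n.+1%:R^-1 *
      \sum_i (Y i - \sum_a X i a 0 * u 0 a) ^+ 2)); last first.
    apply/funext => u; rewrite /F /mean_squared_loss; congr (Num.sqrt (_ * _)).
    apply: eq_bigr => i _; rewrite squared_lossE residualE/=.
    by under eq_bigr do rewrite mxE.
  apply: rms_affine_continuous => a; exact: coord_continuous.
have sd0 : 0 < Num.sqrt delta by rewrite sqrtr_gt0.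
have [b bmin] := penalized_minimum hG halpha pq st sd0
  (fun b => sqrtr_ge0 (mean_squared_loss Z b)) cF.
(* By [worst_case_loss] the robust objective equals the penalized one at every point, so one
   minimizer serves both. *)
exists (F b + Num.sqrt delta * group_norm G alpha p s b)%:E; split; split.
- by exists b; exact: (worst_case_loss hG halpha pq st Z b (ltW hdelta)).
- move=> x; rewrite (worst_case_loss hG halpha pq st Z x (ltW hdelta)).
  by rewrite lee_fin bmin.
- by exists b; rewrite expectation_empirical.
- by move=> x; rewrite expectation_empirical /= lee_fin bmin.
Qed.
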